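(* Let $f:[a,b]\times\mathbb{R}\to\mathbb{R}$ be of class $C^\infty$ and Lipschitz continuous in its second variable with constant $L$, and let $u\in C^\infty[a,b]$ be the solution of $u'(t)=f(t,u(t))$ on $[a,b]$, $u(a)=u_0$. Let the real parameters $c_2,c_3,c_4,a_{21},a_{31},a_{32},a_{41},a_{42},a_{43},w_1,w_2,w_3,w_4$ satisfy $$a_{21}=c_2,\qquad a_{31}+a_{32}=c_3,\qquad a_{41}+a_{42}+a_{43}=c_4,$$ $$w_1+w_2+w_3+w_4=1,\qquad 2(w_2c_2+w_3c_3+w_4c_4)=1,$$ $$3(w_2c_2^2+w_3c_3^2+w_4c_4^2)=1,\qquad 4(w_2c_2^3+w_3c_3^3+w_4c_4^3)=1,$$ $$6(a_{32}w_3c_2+a_{42}w_4c_2+a_{43}w_4c_3)=1,\qquad 8(a_{32}w_3c_2c_3+a_{42}w_4c_2c_4+a_{43}w_4c_3c_4)=1,$$ $$12(a_{32}w_3c_2^2+a_{42}w_4c_2^2+a_{43}w_4c_3^2)=1,\qquad 24a_{32}a_{43}w_4c_2=1.$$ Suppose that the squared shape parameters $\varepsilon_{2i}^2$, $\varepsilon_{3i}^2$ and $\varepsilon_{4i}^2$, $i=0,1,\ldots,N-1$, are bounded (uniformly in $i$ and $N$). Then the MQ-RBF-based RK4 method with these parameters is convergent, i.e. $\mathbf{u}_N\to u(b)$ as $h=(b-a)/N\to0$.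
   Context: For each positive integer $N$ put $h=(b-a)/N$ and $t_i=a+ih$, $i=0,\ldots,N$. Given real numbers $\varepsilon_{2i}^2,\varepsilon_{3i}^2,\varepsilon_{4i}^2$ ($0\le i\le N-1$, possibly negative and possibly depending on $N$), the MQ-RBF-based RK4 method computes approximations $\mathbf{u}_i$ to $u(t_i)$ by $\mathbf{u}_0=u_0$ and $$\mathbf{u}_{i+1}=\mathbf{u}_i+h[w_1K_1+w_2K_2+w_3K_3+w_4K_4],$$ $$K_1=f(t_i,\mathbf{u}_i),\qquad K_2=f\Big(t_i+c_2h,\ \Big(1+\tfrac{\varepsilon_{2i}^2(c_2h)^2}{2}\Big)\big(\mathbf{u}_i+ha_{21}K_1\big)\Big),$$ $$K_3=f\Big(t_i+c_3h,\ \Big(1+\tfrac{\varepsilon_{3i}^2(c_3h)^2}{2}\Big)\big(\mathbf{u}_i+h(a_{31}K_1+a_{32}K_2)\big)\Big),$$ $$K_4=f\Big(t_i+c_4h,\ \Big(1+\tfrac{\varepsilon_{4i}^2(c_4h)^2}{2}\Big)\big(\mathbf{u}_i+h(a_{41}K_1+a_{42}K_2+a_{43}K_3)\big)\Big).$$ For evaluations at times outside $[a,b]$, if any, $f$ is understood to be defined there with the same smoothness and Lipschitz property. *)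

(* Defs.v *)
From mathcomp Require Import all_boot all_order all_algebra.
From mathcomp Require Import all_classical all_reals all_analysis.

Set Implicit Arguments.
Unset Strict Implicit.
Unset Printing Implicit Defensive.

Import Order.TTheory GRing.Theory Num.Theory.
Import numFieldNormedType.Exports.

Local Open Scope classical_set_scope.
Local Open Scope ring_scope.

(* The derivative of [g] at [t] relative to [J]: two-sided at interior points
   of the interval [J], one-sided at the endpoints that belong to [J].  The
   values of [g] outside [J] play no role. *)
Definition has_derivative_in (R : realType) (J : set R) (g : R -> R)
    (t l : R) : Prop :=
  (g s - g t) / (s - t) @[s --> within J t^'] --> l.

Fixpoint class_C1d (R : realType) (k : nat) (J : set R) (g : R -> R) : Prop :=
  match k with
  | 0 => {within J, continuous g}
  | k'.+1 => exists g' : R -> R,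
      (forall t, J t -> has_derivative_in J g t (g' t)) /\ class_C1d k' J g'
  end.

(* C^infinity on an interval [J], derivatives at endpoints being one-sided. *)
Definition smooth_on (R : realType) (J : set R) (g : R -> R) : Prop :=
  forall k, class_C1d k J g.

(* [g] is of class C^k on the strip [J x R], i.e. all its partial derivatives
   of order at most [k] exist and those of order [k] are continuous there
   (t-derivatives being one-sided at the endpoints of [J]).  The lower-order
   ones are then continuous too, since [J x R] is convex. *)
Fixpoint class_C2d (R : realType) (k : nat) (J : set R) (g : R -> R -> R) :
    Prop :=
  match k with
  | 0 => {within J `*` setT, continuous (fun p : R * R => g p.1 p.2)}
  | k'.+1 => exists gt gy : R -> R -> R,
      [/\ forall t y, J t -> has_derivative_in J (fun s => g s y) t (gt t y),
          forall t y : R, J t -> is_derive y (1 : R) (g t) (gy t y),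
          class_C2d k' J gt & class_C2d k' J gy]
  end.

Definition smooth_on_strip (R : realType) (J : set R) (g : R -> R -> R) :
    Prop := forall k, class_C2d k J g.

Definition lipschitz_snd (R : realType) (J : set R) (L : R)
    (f : R -> R -> R) : Prop :=
  forall t y z, J t -> `|f t y - f t z| <= L * `|y - z|.

Definition mesh (R : realType) (a b : R) (N : nat) : R := (b - a) / N%:R.

Definition node (R : realType) (a b : R) (N i : nat) : R :=
  a + i%:R * mesh a b N.

(* [e2], [e3], [e4] stand for the squared shape parameters eps^2 themselves,
   which may be negative; they are never squared here. *)
Definition mq_rk4_step (R : realType) (f : R -> R -> R)
    (c2 c3 c4 a21 a31 a32 a41 a42 a43 w1 w2 w3 w4 : R)
    (h t v e2 e3 e4 : R) : R :=
  let K1 := f t v in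
  let K2 := f (t + c2 * h)
              ((1 + e2 * (c2 * h) ^+ 2 / 2) * (v + h * a21 * K1)) in
  let K3 := f (t + c3 * h)
              ((1 + e3 * (c3 * h) ^+ 2 / 2)
               * (v + h * (a31 * K1 + a32 * K2))) in
  let K4 := f (t + c4 * h)
              ((1 + e4 * (c4 * h) ^+ 2 / 2)
               * (v + h * (a41 * K1 + a42 * K2 + a43 * K3))) in
  v + h * (w1 * K1 + w2 * K2 + w3 * K3 + w4 * K4).

Fixpoint mq_rk4 (R : realType) (f : R -> R -> R) (a b u0 : R)
    (c2 c3 c4 a21 a31 a32 a41 a42 a43 w1 w2 w3 w4 : R)
    (e2 e3 e4 : nat -> nat -> R) (N i : nat) : R :=
  match i with
  | 0 => u0
  | j.+1 =>
      mq_rk4_step f c2 c3 c4 a21 a31 a32 a41 a42 a43 w1 w2 w3 w4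
        (mesh a b N) (node a b N j)
        (mq_rk4 f a b u0 c2 c3 c4 a21 a31 a32 a41 a42 a43 w1 w2 w3 w4
           e2 e3 e4 N j)
        (e2 N j) (e3 N j) (e4 N j)
  end.

(* Main.v *)
(* The shape factors 1 + eps^2 (c h)^2 / 2 are 1 + O(h), so every slope K_j
   differs from f(t_j, u(t_i)), t_j = t_i + c_j h, by O(|u_i - u(t_i)| + h), and
   the latter is uniformly close to u'(t_i) by uniform continuity of f on a
   compact set. As the weights sum to 1, the errors therefore satisfy
   e_(i+1) <= (1 + C h) e_i + h o(1), and the discrete Gronwall inequality yields
   e_N = o(1). *)
Require Import Defs.
From mathcomp Require Import all_boot all_order all_algebra.
From mathcomp Require Import all_classical all_reals all_analysis.
From mathcomp Require Import ring lra.

Set Implicit Arguments.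
Unset Strict Implicit.
Unset Printing Implicit Defensive.

Import Order.TTheory GRing.Theory Num.Theory.
Import numFieldNormedType.Exports.

Local Open Scope classical_set_scope.
Local Open Scope ring_scope.

(** * Discrete Gronwall inequality, compactness and one-sided derivatives *)

(** Induction gives [e i <= i B (1 + A)^i], because the [B] added at step [i] is at most
    [B (1 + A)^(i+1)]; then [1 + A <= exp A]. *)
Lemma discrete_gronwall (R : realType) (e : nat -> R) (A B : R) (n : nat) :
  0 <= A -> 0 <= B -> e 0%N = 0 ->
  (forall i, (i < n)%N -> e i.+1 <= (1 + A) * e i + B) ->
  e n <= n%:R * B * expR (n%:R * A).
Proof.
move=> A0 B0 e0 rec.
have A1 : 1 <= 1 + A by rewrite lerDl.
have bound i : (i <= n)%N -> e i <= i%:R * B * (1 + A) ^+ i.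
  elim: i => [|i IH] lin; first by rewrite e0 !mul0r.
  apply: (le_trans (rec i lin)).
  have : (1 + A) * e i <= (1 + A) * (i%:R * B * (1 + A) ^+ i).
    by rewrite ler_pM2l ?(lt_le_trans ltr01)//; exact: IH (ltnW lin).
  have : B * 1 <= B * (1 + A) ^+ i.+1 by rewrite ler_wpM2l ?exprn_ege1.
  by rewrite -natr1 exprS; nra.
apply: (le_trans (bound n (leqnn n))); rewrite ler_wpM2l ?mulr_ge0//.
by rewrite expRM_natl lerXn2r ?nnegrE ?expR_ge0 ?expR_ge1Dx ?(le_trans ler01).
Qed.

(** Heine-Cantor: a radius valid near each point of [K] becomes one radius for all of [K] by the
    near-covering form of compactness. *)
Lemma compact_unif_continuous (R : realType) (X : pseudoMetricType R)
    (K : set X) (g : X -> R) :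
  compact K -> {within K, continuous g} -> forall eta : R, 0 < eta ->
  exists2 d : R, 0 < d &
    forall x y, K x -> K y -> ball x d y -> `|g x - g y| <= eta.
Proof.
move=> /compact_near_coveringP/near_covering_withinP cK cg eta eta0.
have eta20 : 0 < eta / 2 by rewrite divr_gt0.
have near_ok x : K x -> \forall x' \near x & d \near 0^'+,
    K x' -> forall y, K y -> ball x' d y -> `|g x' - g y| <= eta.
  move=> Kx; move/subspace_continuousP : cg => /(_ x Kx)/cvgrPdist_le/(_ _ eta20).
  rewrite /= near_withinE => /nbhs_ballP[r /= r0 rP].
  have r20 : 0 < r / 2 by rewrite divr_gt0.
  exists (ball x (r / 2), [set d | d < r / 2]) => /=.
    by split; [exact: nbhsx_ballx | exact: nbhs_right_lt].
  (* Half radii keep both [x'] and [y] within [r] of [x], so both values are within [eta / 2] of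
     [g x]. *)
  move=> [x' d] /= [xx' dr] Kx' y Ky x'y.
  have xy : ball x r y.
    rewrite (splitr r); apply: ball_triangle xx' _.
    exact: le_ball (ltW dr) _ x'y.
  have xx'r : ball x r x'.
    by apply: le_ball xx'; rewrite ler_pdivrMr// ler_peMr ?ler1n ?ltW.
  have := rP _ xx'r Kx'; have := rP _ xy Ky; rewrite /from_subspace !ler_norml; lra.
have [d [d0 dP]] := @filter_ex _ (0^'+ : set_system R) _ _
  (filterI (nbhs_right_gt (0 : R)) (cK R _ _ _ near_ok)).
by exists d => // x y Kx; exact: dP.
Qed.

(** Small increments from an interior point stay in [[a, b]]. This supplies the two-sided
    derivatives that the mean value theorem requires. *)
Lemma has_derivative_in_interior (R : realType) (a b : R) (g : R -> R)
    (t l : R) :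
  a < t < b -> has_derivative_in `[a, b]%classic g t l ->
  is_derive t (1 : R) g l.
Proof.
move=> /andP[at_ tb] dg.
have cv : h^-1 *: (g (h *: 1 + t) - g t) @[h --> 0^'] --> (l : R^o).
  apply/cvgrPdist_le => /= eps eps0.
  move/cvgrPdist_le : dg => /(_ _ eps0) /=.
  rewrite !near_withinE !near_simpl => /nbhs_ballP[r /= r0 rP].
  have d0 : 0 < Num.min r (Num.min (t - a) (b - t)).
    by rewrite !lt_min r0 !subr_gt0 at_ tb.
  apply/nbhs_ballP; exists (Num.min r (Num.min (t - a) (b - t))) => //= h.
  rewrite /ball /= sub0r normrN !lt_min => /and3P[hr ha hb] h0.
  rewrite [h *: 1]mulr1 [_ *: _]mulrC.
  have := rP (h + t).
  rewrite addrK; apply.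
  - by rewrite /ball /= opprD addrCA subrr addr0 normrN.
  - by rewrite -subr_eq0 addrK.
  - by move: ha hb; rewrite /= in_itv /= !ltr_norml; lra.
by split; [apply/cvg_ex; exists l | apply/cvg_lim].
Qed.

(** * Perturbation of one stage and of one step *)

(** [C] is uniform in [g], [y], [v], [h], [eps] and [X]. The first bound is the error of a slope;
    the second, its growth, provides the hypothesis on [X] for the next stage. *)
Lemma stage_bound (R : realType) (L U B M H A : R) :
  0 <= L -> 0 <= U -> 0 <= B -> 0 <= M -> 0 <= H -> 0 <= A ->
  exists2 C : R, 0 <= C &
    forall (g : R -> R) (y v h eps X : R),
      (forall z z', `|g z - g z'| <= L * `|z - z'|) ->
      `|y| <= U -> `|g y| <= B -> 0 <= h <= H -> `|eps| <= M * h ->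
      `|X| <= A * (1 + `|v - y|) ->
      `|g ((1 + eps) * (v + h * X)) - g y| <= C * (`|v - y| + h) /\
      `|g ((1 + eps) * (v + h * X))| <= C * (1 + `|v - y|).
Proof.
move=> L0 U0 B0 M0 H0 A0.
(* [P] adds up the coefficients of [E] and of [h] in the bounds [t1] to [t3] below, with
   [h E <= H E]. *)
pose P := 1 + M * H + (1 + M * H) * A * H + M * U + (1 + M * H) * A.
have MH0 : 0 <= M * H by rewrite mulr_ge0.
have P0 : 0 <= P by rewrite /P !(addr_ge0, mulr_ge0).
have LP0 : 0 <= L * P by rewrite mulr_ge0.
(* The first bound needs [L P]; the second needs [B + L P (E + h)] with [h <= H]. *)
exists (B + L * P * (1 + H)).
  by rewrite !(addr_ge0, mulr_ge0).
move=> g y v h eps X gL yU gB /andP[h0 hH] epsM XA.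
set E := `|v - y| in XA *; have E0 : 0 <= E by exact: normr_ge0.
set Y := (1 + eps) * (v + h * X).
have YE : `|Y - y| <= P * (E + h).
  have -> : Y - y = (v - y) + eps * (v - y) + eps * y + (1 + eps) * (h * X).
    by rewrite /Y; ring.
  have t1 : `|eps * (v - y)| <= M * H * E.
    by rewrite normrM ler_pM// (le_trans epsM)// ler_wpM2l.
  have t2 : `|eps * y| <= M * U * h.
    by rewrite normrM mulrAC ler_pM.
  have t3 : `|(1 + eps) * (h * X)| <= (1 + M * H) * (h * (A * (1 + E))).
    rewrite normrM ler_pM//.
      rewrite (le_trans (ler_normD _ _))// normr1 lerD2l (le_trans epsM)//.
      by rewrite ler_wpM2l.
    by rewrite normrM (ger0_norm h0) ler_wpM2l.
  have t4 : (1 + M * H) * A * (h * E) <= (1 + M * H) * A * (H * E).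
    by rewrite ler_wpM2l ?ler_wpM2r// !(addr_ge0, mulr_ge0).
  have q1 : 0 <= (1 + M * H) * A * E by rewrite !(addr_ge0, mulr_ge0).
  have q2 : 0 <= M * U * E by rewrite !mulr_ge0.
  have q3 : 0 <= (1 + M * H) * A * H * h by rewrite !(addr_ge0, mulr_ge0).
  have q4 : 0 <= M * H * h by rewrite !mulr_ge0.
  have := ler_normD (v - y + eps * (v - y) + eps * y) ((1 + eps) * (h * X)).
  have := ler_normD (v - y + eps * (v - y)) (eps * y).
  have := ler_normD (v - y) (eps * (v - y)).
  rewrite -/E /P; lra.
have gE : `|g Y - g y| <= L * P * (E + h).
  by rewrite (le_trans (gL _ _))// -mulrA ler_wpM2l.
have LPE : 0 <= L * P * E by rewrite mulr_ge0.
have LPh : L * P * h <= L * P * H by rewrite ler_wpM2l.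
have Bh : 0 <= (B + L * P * H) * (E + h) by rewrite !(addr_ge0, mulr_ge0).
have BE : 0 <= (B + L * P * H) * E by rewrite !(addr_ge0, mulr_ge0).
split; first lra.
have := ler_normD (g Y - g y) (g y); rewrite subrK; lra.
Qed.

(** The step is compared with an Euler step from [v] whose slope is taken at the reference value
    [y]. [om] measures how much [f] at [y] changes between [t] and the stage times. *)
Lemma mq_rk4_step_bound (R : realType)
    (c2 c3 c4 a21 a31 a32 a41 a42 a43 w1 w2 w3 w4 L U B M H : R) :
  0 <= L -> 0 <= U -> 0 <= B -> 0 <= M -> 0 <= H ->
  w1 + w2 + w3 + w4 = 1 ->
  exists2 C : R, 0 <= C &
    forall (f : R -> R -> R) (t y v h e2 e3 e4 om : R),
      `|y| <= U -> 0 <= h <= H -> 0 <= om ->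
      `|e2| <= M -> `|e3| <= M -> `|e4| <= M ->
      (forall c, c \in [:: 0; c2; c3; c4] ->
        [/\ forall z z', `|f (t + c * h) z - f (t + c * h) z'| <= L * `|z - z'|,
            `|f (t + c * h) y| <= B & `|f (t + c * h) y - f t y| <= om]) ->
      `|mq_rk4_step f c2 c3 c4 a21 a31 a32 a41 a42 a43 w1 w2 w3 w4
          h t v e2 e3 e4 - (v + h * f t y)| <=
      h * (C * (`|v - y| + h + om)).
Proof.
move=> L0 U0 B0 M0 H0 w_sum.
(* One factor [h] of [e (c h)^2 / 2] is bounded by [H], which leaves the linear bound [M' c * h]. *)
pose M' c := M * c ^+ 2 * H / 2.
have M'0 c : 0 <= M' c by rewrite /M' divr_ge0// mulr_ge0// mulr_ge0// sqr_ge0.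
have [C1 C10 K1P] := @stage_bound R L U B 0 H 0 L0 U0 B0 (lexx 0) H0 (lexx 0).
pose A2 := `|a21| * C1.
have A20 : 0 <= A2 by rewrite mulr_ge0.
have [C2 C20 K2P] := @stage_bound R L U B (M' c2) H A2 L0 U0 B0 (M'0 c2) H0 A20.
pose A3 := `|a31| * C1 + `|a32| * C2.
have A30 : 0 <= A3 by rewrite addr_ge0 ?mulr_ge0.
have [C3 C30 K3P] := @stage_bound R L U B (M' c3) H A3 L0 U0 B0 (M'0 c3) H0 A30.
pose A4 := `|a41| * C1 + `|a42| * C2 + `|a43| * C3.
have A40 : 0 <= A4 by rewrite !addr_ge0 ?mulr_ge0.
have [C4 C40 K4P] := @stage_bound R L U B (M' c4) H A4 L0 U0 B0 (M'0 c4) H0 A40.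
pose W := `|w1| + `|w2| + `|w3| + `|w4|.
pose D := C1 + C2 + C3 + C4.
have D0 : 0 <= D by rewrite /D !addr_ge0.
have W0 : 0 <= W by rewrite /W !addr_ge0.
have [C1D C2D C3D C4D] : [/\ C1 <= D, C2 <= D, C3 <= D & C4 <= D].
  by rewrite /D; move: C10 C20 C30 C40; clear; split; lra.
exists (W * (1 + D)); first by rewrite !(addr_ge0, mulr_ge0).
move=> f t y v h e2 e3 e4 om yU hH om0 e2M e3M e4M fP.
have /andP[h0 hH'] := hH.
have epsP c e : `|e| <= M -> `|e * (c * h) ^+ 2 / 2| <= M' c * h.
  move=> eM; rewrite exprMn normrM normfV (ger0_norm (ler0n _ 2)) (normrM e).
  rewrite (ger0_norm (mulr_ge0 (sqr_ge0 c) (sqr_ge0 h))).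
  have : `|e| * (c ^+ 2 * (h * h)) <= M * (c ^+ 2 * (H * h)).
    rewrite ler_pM//; first by rewrite mulr_ge0 ?sqr_ge0// mulr_ge0.
    by rewrite ler_wpM2l ?sqr_ge0// ler_wpM2r.
  by rewrite /M' (expr2 h); clear; lra.
(* The first slope is a stage with [c = 0], no shape factor and no increment, so the same lemma
   covers it. *)
have K1E : f t v = f (t + 0 * h) ((1 + 0) * (v + h * 0)).
  by rewrite mul0r mulr0 !addr0 mul1r.
rewrite /mq_rk4_step.
set K1 := f t v.
set K2 := f (t + c2 * h) _.
set K3 := f (t + c3 * h) _.
set K4 := f (t + c4 * h) _.
have [lip0 B_0 om_0] := fP 0 (mem_head _ _).
have [] := fP c2 _; first by rewrite !inE eqxx orbT.
move=> lip2 B_2 om_2.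
have [] := fP c3 _; first by rewrite !inE eqxx !orbT.
move=> lip3 B_3 om_3.
have [] := fP c4 _; first by rewrite !inE eqxx !orbT.
move=> lip4 B_4 om_4.
have [] := K1P _ y v h 0 0 lip0 yU B_0 hH.
- by rewrite normr0 mul0r.
- by rewrite normr0 mul0r.
rewrite -K1E -/K1 => d1 b1.
set E := `|v - y| in d1 b1 *; have E0 : 0 <= E by exact: normr_ge0.
have scale (x k C : R) : `|k| <= C * (1 + E) -> `|x * k| <= `|x| * C * (1 + E).
  by move=> kC; rewrite normrM -mulrA ler_wpM2l.
have [] := K2P _ y v h _ (a21 * K1) lip2 yU B_2 hH (epsP c2 e2 e2M).
  exact: scale.
rewrite mulrA -/K2 -/E => d2 b2.
have [] := K3P _ y v h _ (a31 * K1 + a32 * K2) lip3 yU B_3 hH (epsP c3 e3 e3M).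
  by rewrite (le_trans (ler_normD _ _))// mulrDl lerD ?scale.
rewrite -/K3 -/E => d3 b3.
have [] := K4P _ y v h _ (a41 * K1 + a42 * K2 + a43 * K3) lip4 yU B_4 hH
  (epsP c4 e4 e4M).
  rewrite (le_trans (ler_normD _ _))// [in leRHS]mulrDl lerD ?scale//.
  by rewrite (le_trans (ler_normD _ _))// [in leRHS]mulrDl lerD ?scale.
rewrite -/K4 -/E => d4 b4.
(* As the weights sum to 1, [f t y] can be subtracted from each slope separately. *)
have -> : v + h * (w1 * K1 + w2 * K2 + w3 * K3 + w4 * K4) - (v + h * f t y) =
    h * (w1 * (K1 - f t y) + w2 * (K2 - f t y) + w3 * (K3 - f t y)
         + w4 * (K4 - f t y)).
  rewrite -[f t y in LHS]mul1r -w_sum; ring.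
rewrite normrM (ger0_norm h0) ler_wpM2l//.
have weigh (w k k' C : R) : 0 <= C -> C <= D -> `|k - k'| <= C * (E + h) ->
    `|k' - f t y| <= om -> `|w * (k - f t y)| <= `|w| * ((1 + D) * (E + h + om)).
  move=> C0' CD kk' k'o; rewrite normrM ler_wpM2l//.
  have := ler_normD (k - k') (k' - f t y); rewrite addrA subrK.
  have : C * (E + h) <= D * (E + h) by rewrite ler_wpM2r ?addr_ge0.
  have : 0 <= D * om by rewrite mulr_ge0.
  by move: kk' k'o E0 h0; clear; lra.
rewrite -mulrA; move: weigh; set Z := (1 + D) * _ => weigh; rewrite /W !mulrDl.
do ?[apply: le_trans (ler_normD _ _) _; apply: lerD].
- by apply: (weigh _ _ _ _ _ _ d1).
- by apply: (weigh _ _ _ _ _ _ d2).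
- by apply: (weigh _ _ _ _ _ _ d3).
- by apply: (weigh _ _ _ _ _ _ d4).
Qed.

(** * Uniform continuity of [f] along the solution, and increments of the solution *)

(** The map [(s, t) -> f s (u t)] is continuous on a compact rectangle. The two times are
    independent because a stage time [s] may leave [[a, b]], while [u] is evaluated at nodes. *)
Lemma unif_continuous_along (R : realType) (a b lo hi : R) (J : set R)
    (f : R -> R -> R) (u : R -> R) :
  {within J `*` setT, continuous (fun p : R * R => f p.1 p.2)} ->
  {within `[a, b], continuous u} -> `[lo, hi] `<=` J ->
  (exists2 B : R, 0 <= B &
    forall s t, s \in `[lo, hi] -> t \in `[a, b] -> `|f s (u t)| <= B) /\
  forall eta : R, 0 < eta -> exists2 d : R, 0 < d &
    forall s s' t t', s \in `[lo, hi] -> s' \in `[lo, hi] ->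
      t \in `[a, b] -> t' \in `[a, b] -> `|s - s'| < d -> `|t - t'| < d ->
      `|f s (u t) - f s' (u t')| <= eta.
Proof.
move=> cf cu sub.
pose K := `[lo, hi]%classic `*` `[a, b]%classic.
have cK : compact K by apply: compact_setX; exact: segment_compact.
have cg : {within K, continuous (fun p : R * R => f p.1 (u p.2))}.
  apply/subspace_continuousP => -[s t] [/= sI tI].
  have JT : (J `*` [set: R]) (s, u t) by split => //; exact: sub.
  apply/cvgrPdist_le => /= eps eps0.
  move/subspace_continuousP : cf => /(_ _ JT)/cvgrPdist_le/(_ _ eps0).
  rewrite /= => -[[V1 V2] /= [V1s V2u] VP].
  move/subspace_continuousP : cu => /(_ t tI V2 V2u).
  rewrite /= nbhs_simpl /= => uV2.
  exists (V1, [set x | `[a, b]%classic x -> V2 (u x)]) => //=.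
  move=> -[s' t'] [/= s'V t'V] [/= s'I t'I]; apply: (VP (s', u t')).
    by split => //; exact: t'V.
  by split => //; exact: sub.
split; last first.
  move=> eta eta0; have [d d0 dP] := compact_unif_continuous cK cg eta0.
  exists d => // s s' t t' sI s'I tI t'I ss tt.
  exact: (dP (s, t) (s', t')).
have /compact_bounded[M [_ MP]] := continuous_compact cg cK.
(* Boundedness holds for every constant strictly above [M]; the maximum with 0 makes this one
   nonnegative. *)
exists (Num.max 0 M + 1); first by rewrite addr_ge0// le_max lexx.
move=> s t sI tI; apply: (MP (Num.max 0 M + 1)).
  by rewrite ltr_pwDr// le_max lexx orbT.
by exists (s, t).
Qed.

(** By the mean value theorem the increment is [(t - s) u'(x)] for some [x] in between. This bounds
    the defect of the exact solution in an Euler step. *)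
Lemma derivative_increment_bound (R : realType) (a b : R) (u u' : R -> R)
    (s t eta : R) :
  a <= s -> s < t -> t <= b -> {within `[a, b], continuous u} ->
  (forall x, `[a, b]%classic x -> has_derivative_in `[a, b]%classic u x (u' x)) ->
  (forall x, x \in `[s, t] -> `|u' x - u' s| <= eta) ->
  `|u t - u s - (t - s) * u' s| <= (t - s) * eta.
Proof.
move=> as_ st tb cu du u'P.
have [| |x xst ->] := @MVT R u u' s t st.
- move=> x; rewrite in_itv /= => /andP[sx xt].
  apply: (@has_derivative_in_interior R a b).
    by rewrite (le_lt_trans as_ sx) (lt_le_trans xt tb).
  by apply: du; rewrite /= in_itv /=; lra.
- apply: continuous_subspaceW cu => x /=; rewrite !in_itv /=; lra.
rewrite mulrC -mulrBr normrM gtr0_norm ?subr_gt0// ler_wpM2l ?subr_ge0 ?(ltW st)//.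
by apply: u'P; exact: subset_itv_oo_cc.
Qed.

(** * Location of nodes and stage times, and regularity there *)

Lemma node_mem (R : realType) (a b : R) (N i : nat) :
  a < b -> (0 < N)%N -> (i <= N)%N -> node a b N i \in `[a, b].
Proof.
move=> ab N0 iN; have N0' : 0 < N%:R :> R by rewrite ltr0n.
have h0 : 0 < mesh a b N by rewrite divr_gt0 ?subr_gt0.
have Nh : N%:R * mesh a b N = b - a by rewrite mulrC divfK ?gt_eqF.
have iNR : i%:R <= N%:R :> R by rewrite ler_nat.
have : i%:R * mesh a b N <= N%:R * mesh a b N by rewrite ler_wpM2r ?(ltW h0).
have : 0 <= i%:R * mesh a b N by rewrite mulr_ge0 ?(ltW h0).
by rewrite in_itv /= /node Nh; lra.
Qed.

(* [a + c (b - a)] is the stage time of the one-step mesh. Since it lies in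
   [J], all stage times of all meshes stay in one compact subinterval of [J],
   even when [J] is not closed. *)
Lemma stage_time_mem (R : realType) (a b c : R) (N i : nat) :
  a < b -> (0 < N)%N -> (i < N)%N ->
  node a b N i + c * mesh a b N \in
    `[Num.min a (a + c * (b - a)), Num.max b (a + c * (b - a))].
Proof.
move=> ab N0 iN; have N0' : 0 < N%:R :> R by rewrite ltr0n.
have h0 : 0 < mesh a b N by rewrite divr_gt0 ?subr_gt0.
have Nh : b - a = N%:R * mesh a b N by rewrite mulrC divfK ?gt_eqF.
have iNR : i%:R + 1 <= N%:R :> R by rewrite natr1 ler_nat.
have i0 : 0 <= i%:R :> R by [].
have affine x y : x <= y -> a + x * mesh a b N <= a + y * mesh a b N.
  by move=> xy; rewrite lerD2l ler_wpM2r ?(ltW h0).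
have -> : node a b N i + c * mesh a b N = a + (i%:R + c) * mesh a b N.
  by rewrite /node mulrDl addrA.
have from_a x : 0 <= x -> a <= a + x * mesh a b N.
  by move=> x0; rewrite lerDl mulr_ge0 ?(ltW h0).
have upto_b x : x <= N%:R -> a + x * mesh a b N <= b.
  by move=> /affine; rewrite -Nh [in leRHS]addrC subrK.
rewrite in_itv /= ge_min le_max Nh mulrA.
(* With [i <= N - 1]: if [c < 0] then [c N <= i + c <= N]; if [0 <= c <= 1] then [0 <= i + c <= N];
   if [c > 1] then [0 <= i + c <= c N]. *)
have [c0|c0] := ltP c 0.
  by rewrite affine ?orbT ?upto_b//; nra.
rewrite from_a ?addr_ge0//=.
by have [c1|c1] := leP c 1; [rewrite upto_b//; nra | rewrite affine ?orbT//; nra].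
Qed.

(** [B] is chosen before [eta]: the error constant will depend on [B], and [eta] on that
    constant. *)
Lemma stage_time_regular (R : realType) (a b c : R) (J : set R)
    (f : R -> R -> R) (u : R -> R) :
  a < b -> is_interval J -> `[a, b]%classic `<=` J -> J (a + c * (b - a)) ->
  {within J `*` setT, continuous (fun p : R * R => f p.1 p.2)} ->
  {within `[a, b], continuous u} ->
  exists2 B : R, 0 <= B & forall eta : R, 0 < eta -> exists2 d : R, 0 < d &
    forall N i, (i < N)%N -> mesh a b N < d ->
      let s := node a b N i + c * mesh a b N in
      [/\ J s, `|f s (u (node a b N i))| <= B &
          `|f s (u (node a b N i)) - f (node a b N i) (u (node a b N i))| <= eta].
Proof.
move=> ab iJ abJ Jc cf cu.
set lo := Num.min a (a + c * (b - a)); set hi := Num.max b (a + c * (b - a)).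
have Ja : J a by apply: abJ; rewrite /= in_itv /= lexx ltW.
have Jb : J b by apply: abJ; rewrite /= in_itv /= lexx ltW.
have Jlo : J lo by rewrite /lo minEle; case: ifP.
have Jhi : J hi by rewrite /hi maxEle; case: ifP.
have hull : `[lo, hi]%classic `<=` J.
  by move=> x /=; rewrite in_itv /= => xI; apply: iJ xI.
have [[B B0 BP] uc] := unif_continuous_along cf cu hull.
exists B => // eta eta0; have [d d0 dP] := uc eta eta0.
(* This makes [|c| h < d]; the added 1 covers [c = 0]. *)
exists (d / (`|c| + 1)); first by rewrite divr_gt0// ltr_wpDl.
move=> N i iN hd s.
have N0 : (0 < N)%N by exact: leq_ltn_trans iN.
have sI : s \in `[lo, hi] by exact: stage_time_mem.
have tab : node a b N i \in `[a, b] by apply: node_mem => //; exact: ltnW.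
(* The node lies in the same hull, so one modulus of continuity compares it with the stage time. *)
have tI : node a b N i \in `[lo, hi].
  move: tab; rewrite !in_itv /= => /andP[at_ tb].
  by rewrite ge_min at_ le_max tb.
have h0 : 0 <= mesh a b N by rewrite divr_ge0// subr_ge0 ltW.
split; [exact: hull | exact: BP | apply: dP => //].
  rewrite /s addrAC subrr add0r normrM (ger0_norm h0).
  move: hd; rewrite ltr_pdivlMr ?ltr_wpDl//; nra.
by rewrite subrr normr0.
Qed.

(** * Convergence of the method *)

Theorem theorem3 (R : realType) (a b : R) (hab : a < b)
  (* [J] is the interval of times on which [f] is defined: it contains [a, b]
     and the stage times t_i + c_j h, if some of them leave [a, b]. *)
  (J : set R) (hJ : is_interval J) (habJ : `[a, b]%classic `<=` J)
  (f : R -> R -> R) (L : R)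
  (hf : smooth_on_strip J f) (hL : lipschitz_snd J L f)
  (u : R -> R) (u0 : R)
  (hu : smooth_on `[a, b]%classic u)
  (hode : forall t, `[a, b]%classic t ->
            has_derivative_in `[a, b]%classic u t (f t (u t)))
  (hu0 : u a = u0)
  (c2 c3 c4 a21 a31 a32 a41 a42 a43 w1 w2 w3 w4 : R)
  (hstages : forall N i : nat, (0 < N)%N -> (i < N)%N ->
     [/\ J (node a b N i + c2 * mesh a b N),
         J (node a b N i + c3 * mesh a b N) &
         J (node a b N i + c4 * mesh a b N)])
  (ha2 : a21 = c2)
  (ha3 : a31 + a32 = c3)
  (ha4 : a41 + a42 + a43 = c4)
  (ho1 : w1 + w2 + w3 + w4 = 1)
  (ho2 : 2 * (w2 * c2 + w3 * c3 + w4 * c4) = 1)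
  (ho3 : 3 * (w2 * c2 ^+ 2 + w3 * c3 ^+ 2 + w4 * c4 ^+ 2) = 1)
  (ho4 : 4 * (w2 * c2 ^+ 3 + w3 * c3 ^+ 3 + w4 * c4 ^+ 3) = 1)
  (ho5 : 6 * (a32 * w3 * c2 + a42 * w4 * c2 + a43 * w4 * c3) = 1)
  (ho6 : 8 * (a32 * w3 * c2 * c3 + a42 * w4 * c2 * c4 + a43 * w4 * c3 * c4) = 1)
  (ho7 : 12 * (a32 * w3 * c2 ^+ 2 + a42 * w4 * c2 ^+ 2 + a43 * w4 * c3 ^+ 2) = 1)
  (ho8 : 24 * a32 * a43 * w4 * c2 = 1)
  (e2 e3 e4 : nat -> nat -> R)
  (heps : exists M : R, forall N i : nat, (0 < N)%N -> (i < N)%N ->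
     [/\ `|e2 N i| <= M, `|e3 N i| <= M & `|e4 N i| <= M]) :
  mq_rk4 f a b u0 c2 c3 c4 a21 a31 a32 a41 a42 a43 w1 w2 w3 w4 e2 e3 e4 N N
    @[N --> \oo] --> u b.
Proof.
have ba0 : 0 < b - a by rewrite subr_gt0.
have Ja : J a by apply: habJ; rewrite /= in_itv /= lexx ltW.
have cu : {within `[a, b], continuous u} := hu 0%N.
have cf : {within J `*` setT, continuous (fun p : R * R => f p.1 p.2)} := hf 0%N.
have L0 : 0 <= L.
  by have := hL a 1 0 Ja; rewrite subr0 normr1 mulr1; exact: le_trans.
have [M hM] := heps.
have M0 : 0 <= M by have [+ _ _] := hM 1%N 0%N isT isT; exact: le_trans.
have [U U0 hU] : exists2 U : R, 0 <= U & forall t, t \in `[a, b] -> `|u t| <= U.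
  have /compact_bounded[V [_ hV]] := continuous_compact cu (@segment_compact R a b).
  exists (Num.max 0 V + 1); first by rewrite addr_ge0// le_max lexx.
  move=> t tab; apply: (hV (Num.max 0 V + 1)); last by exists t.
  by rewrite ltr_pwDr// le_max lexx orbT.
(* For [N = 1] and [i = 0] the stage times are [a + c_j (b - a)], the extreme points that determine
   the hulls. *)
have [Jc2 Jc3 Jc4] := hstages 1%N 0%N isT isT.
rewrite /node /mesh mul0r addr0 divr1 in Jc2 Jc3 Jc4.
have Jc0 : J (a + 0 * (b - a)) by rewrite mul0r addr0.
have [B1 B10 reg1] := stage_time_regular hab hJ habJ Jc0 cf cu.
have [B2 B20 reg2] := stage_time_regular hab hJ habJ Jc2 cf cu.
have [B3 B30 reg3] := stage_time_regular hab hJ habJ Jc3 cf cu.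
have [B4 B40 reg4] := stage_time_regular hab hJ habJ Jc4 cf cu.
pose B := B1 + B2 + B3 + B4.
have B0 : 0 <= B by rewrite /B !addr_ge0.
have [B1B B2B B3B B4B] : [/\ B1 <= B, B2 <= B, B3 <= B & B4 <= B].
  by rewrite /B; move: B10 B20 B30 B40; clear; split; lra.
have [C C0 hC] := mq_rk4_step_bound c2 c3 c4 a21 a31 a32 a41 a42 a43 L0 U0 B0
  M0 (ltW ba0) ho1.
have [_ ucF] := unif_continuous_along cf cu habJ.
apply/cvgrPdist_le => /= eps eps0.
(* Gronwall will end with the bound [eta * G]. In [2 C + 1], one [C] comes from [om = eta], the
   other from [h < eta], and the 1 from the increment of [u]. *)
pose G := (b - a) * (2 * C + 1) * expR ((b - a) * C).
have G0 : 0 < G by rewrite !mulr_gt0 ?expR_gt0// ltr_wpDl// mulr_ge0.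
pose eta := eps / G; have eta0 : 0 < eta by rewrite divr_gt0.
(* [d0] controls the oscillation of [u' = f(x, u x)] within one step; [d1] to [d4] control the stage
   times. *)
have [d0 d00 dF] := ucF eta eta0.
have [d1 d10 {}reg1] := reg1 eta eta0.
have [d2 d20 {}reg2] := reg2 eta eta0.
have [d3 d30 {}reg3] := reg3 eta eta0.
have [d4 d40 {}reg4] := reg4 eta eta0.
have small (d : R) : 0 < d -> \forall N \near \oo, mesh a b N < d.
  move=> d_gt0; near=> N; rewrite /mesh ltr_pdivrMr.
    by rewrite mulrC -ltr_pdivrMr//; near: N; exact: nbhs_infty_gtr.
  by rewrite ltr0n; near: N; exact: nbhs_infty_gt.
near=> N.
have N0 : (0 < N)%N by near: N; exact: nbhs_infty_gt.
have hd0 : mesh a b N < d0 by near: N; exact: small.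
have hd1 : mesh a b N < d1 by near: N; exact: small.
have hd2 : mesh a b N < d2 by near: N; exact: small.
have hd3 : mesh a b N < d3 by near: N; exact: small.
have hd4 : mesh a b N < d4 by near: N; exact: small.
have heta : mesh a b N < eta by near: N; exact: small.
have hba : mesh a b N <= b - a.
  by rewrite ler_pdivrMr ?ltr0n// ler_peMr ?ler1n ?ltW.
set h := mesh a b N in hd0 hd1 hd2 hd3 hd4 heta hba.
have Nh : N%:R * h = b - a by rewrite mulrC divfK ?gt_eqF ?ltr0n.
have h0 : 0 < h by rewrite divr_gt0 ?ltr0n.
pose v := mq_rk4 f a b u0 c2 c3 c4 a21 a31 a32 a41 a42 a43 w1 w2 w3 w4 e2 e3 e4 N.
pose e i := `|v i - u (node a b N i)|.
have node_N : node a b N N = b by rewrite /node Nh addrC subrK.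
have e0 : e 0%N = 0 by rewrite /e /= /node mul0r addr0 hu0 subrr normr0.
have rec i : (i < N)%N -> e i.+1 <= (1 + h * C) * e i + h * ((2 * C + 1) * eta).
  move=> iN; rewrite /e.
  have nodeS : node a b N i.+1 = node a b N i + h.
    by rewrite /node -natr1 mulrDl mul1r addrA.
  have ti := node_mem hab N0 (ltnW iN); have tS := node_mem hab N0 iN.
  set t := node a b N i in nodeS ti *.
  rewrite nodeS in tS *.
  have incr : `|u (t + h) - u t - (t + h - t) * f t (u t)| <= (t + h - t) * eta.
    move: (ti) (tS); rewrite !in_itv /= => /andP[at_ tb] /andP[_ tSb].
    apply: (@derivative_increment_bound R a b u (fun x => f x (u x))) => //.
      by rewrite ltrDl.
    move=> x; rewrite in_itv /= => /andP[tx xt].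
    have xab : x \in `[a, b] by rewrite in_itv /= (le_trans at_ tx) (le_trans xt tSb).
    have xd : `|x - t| < d0
      by rewrite ger0_norm ?subr_ge0// (le_lt_trans _ hd0)// lerBlDl.
    exact: dF.
  rewrite [t + h - t]addrAC subrr add0r in incr.
  have [e2M e3M e4M] := hM N i N0 iN.
  have := hC f t (u t) (v i) h (e2 N i) (e3 N i) (e4 N i) eta (hU _ ti).
  rewrite (ltW h0) hba => /(_ isT (ltW eta0) e2M e3M e4M).
  set w := mq_rk4_step _ _ _ _ _ _ _ _ _ _ _ _ _ _ _ _ _ _ _ _.
  have -> : v i.+1 = w by [].
  move=> step; have {}step : `|w - (v i + h * f t (u t))| <=
      h * (C * (`|v i - u t| + h + eta)).
    apply: step => c; rewrite !inE.
    case/or4P => /eqP ->.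
    - have [Js Bs os] := reg1 N i iN hd1.
      by split=> // [z z'|]; [exact: hL | exact: le_trans Bs _].
    - have [Js Bs os] := reg2 N i iN hd2.
      by split=> // [z z'|]; [exact: hL | exact: le_trans Bs _].
    - have [Js Bs os] := reg3 N i iN hd3.
      by split=> // [z z'|]; [exact: hL | exact: le_trans Bs _].
    - have [Js Bs os] := reg4 N i iN hd4.
      by split=> // [z z'|]; [exact: hL | exact: le_trans Bs _].
  (* The new error splits into the deviation of the step from an Euler step with exact slope, the
     old error, and the Euler defect of [u]. *)
  have -> : w - u (t + h) = (w - (v i + h * f t (u t))) + (v i - u t)
      - (u (t + h) - u t - h * f t (u t)) by ring.
  apply: le_trans (ler_normB _ _) _.
  apply: le_trans (lerD (ler_normD _ _) (lexx _)) _.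
  have : h * (C * h) <= h * (C * eta).
    by rewrite ler_wpM2l ?(ltW h0)// ler_wpM2l ?(ltW heta).
  by move: step incr; clear; lra.
have A0 : 0 <= h * C by rewrite mulr_ge0 ?(ltW h0).
have D0 : 0 <= h * ((2 * C + 1) * eta).
  by rewrite mulr_ge0 ?(ltW h0)// mulr_ge0 ?(ltW eta0)// addr_ge0 ?mulr_ge0.
rewrite distrC; have := discrete_gronwall A0 D0 e0 rec.
rewrite {1}/e node_N => /le_trans; apply.
(* Since [N h = b - a], the accumulated bound no longer depends on [N]. *)
rewrite (mulrA _ h) (mulrA _ h C) Nh.
have -> : (b - a) * ((2 * C + 1) * eta) * expR ((b - a) * C) = eta * G.
  by rewrite /G; ring.
by rewrite divfK ?gt_eqF.
Unshelve. all: by end_near.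
Qed.
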